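(* A graph $G$ is a Sterboul--Deming graph with a perfect matching if and only if $\mathrm{Posy}(G)\setminus \mathrm{Flower}(G)=V(G)$.
   Context: All graphs are finite, undirected and simple. Let $M$ be a matching of a graph $G$. A path (or walk) is $M$-alternating if, of any two consecutive edges, exactly one belongs to $M$; an $mm$-$M$-path is an $M$-alternating path whose first and last edges are in $M$. An $M$-blossom is an odd cycle of length $2k+1$ with exactly $k$ edges in $M$; its base is the unique vertex of the cycle not covered by those $k$ edges. An $M$-Tflower consists of an $M$-blossom together with an $M$-stem, i.e. an $M$-alternating path of even length (possibly zero) connecting the base of the blossom to a vertex not saturated by $M$ in $G$, where the base is the only common vertex of the blossom and the stem. An $M$-Tposy consists of two $M$-blossoms joined by an $mm$-$M$-path whose endpoints are the bases of the two blossoms, such that no internal vertex of the path lies in the blossoms and the intersection of the two blossoms is either empty or an $mm$-$M$-path. $\mathrm{Posy}(G)$ is the set of vertices of $G$ that belong to an $M$-Tposy for some maximum matching $M$ of $G$, and $\mathrm{Flower}(G)$ is the set of vertices of $G$ that belong to an $M$-Tflower for some maximum matching $M$ of $G$. Define $SD(G)=\mathrm{Posy}(G)\cup\mathrm{Flower}(G)$ and $KE(G)=V(G)\setminus SD(G)$. A graph $G$ is a Sterboul--Deming graph if $KE(G)=\emptyset$. *)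

(* Defs.v *)
From HB Require Import structures.
From mathcomp Require Import all_boot.
From mathcomp Require Import boolp.

Set Implicit Arguments.
Unset Strict Implicit.
Unset Printing Implicit Defensive.

(* A finite simple graph is a symmetric irreflexive relation [e] on a finite  *)
(* type [T]; an edge is the two-element set of its ends.                      *)
Definition edges (T : finType) (e : rel T) : {set {set T}} :=
  [set [set xy.1; xy.2] | xy : T * T & e xy.1 xy.2].

Definition is_matching (T : finType) (e : rel T) (M : {set {set T}}) : bool :=
  (M \subset edges e) && trivIset M.

Definition maximum_matching (T : finType) (e : rel T)
    (M : {set {set T}}) : bool :=
  is_matching e M &&
  [forall M' : {set {set T}}, is_matching e M' ==> (#|M'| <= #|M|)].

Definition saturated (T : finType) (M : {set {set T}}) (v : T) : bool :=
  v \in cover M.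

Definition perfect_matching (T : finType) (e : rel T)
    (M : {set {set T}}) : bool :=
  is_matching e M && [forall v, saturated M v].

(* As in path.v, the pair (x, p) stands for the vertex sequence x :: p; its   *)
(* length as a path is [size p].                                              *)
Definition path_edges (T : finType) (x : T) (p : seq T) : seq {set T} :=
  pairmap (fun y z => [set y; z]) x p.

Definition cycle_edges (T : finType) (c : seq T) : seq {set T} :=
  if c is x :: p then path_edges x (rcons p x) else [::].

Definition alternating_path (T : finType) (e : rel T) (M : {set {set T}})
    (x : T) (p : seq T) : bool :=
  [&& path e x p, uniq (x :: p) &
      sorted (fun a b : {set T} => (a \in M) (+) (b \in M)) (path_edges x p)].

Definition mm_path (T : finType) (e : rel T) (M : {set {set T}})
    (x : T) (p : seq T) : bool :=
  alternating_path e M x p &&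
  (if path_edges x p is a :: s then (a \in M) && (last a s \in M) else false).

Definition blossom (T : finType) (e : rel T) (M : {set {set T}})
    (c : seq T) : bool :=
  [&& 2 < size c, ucycleb e c &
      size c == (count [in M] (cycle_edges c)).*2.+1].

Definition is_base (T : finType) (M : {set {set T}}) (c : seq T) (b : T) :
    bool :=
  [set v in c] :\: cover ([set:: cycle_edges c] :&: M) == [set b].

(* The stem is (b, p), starting at the base b of the blossom c.               *)
Definition Tflower (T : finType) (e : rel T) (M : {set {set T}})
    (c : seq T) (b : T) (p : seq T) : bool :=
  [&& blossom e M c, is_base M c b, alternating_path e M b p, ~~ odd (size p),
      ~~ saturated M (last b p) & [set v in c] :&: [set v in b :: p] == [set b]].

(* The intersection is that of subgraphs: both vertices and edges.            *)
Definition meet_in_mm_path (T : finType) (e : rel T) (M : {set {set T}})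
    (c1 c2 : seq T) : Prop :=
  exists x p, [/\ mm_path e M x p,
    [set v in c1] :&: [set v in c2] = [set v in x :: p] &
    [set:: cycle_edges c1] :&: [set:: cycle_edges c2] = [set:: path_edges x p]].

(* The joining path is (b, p); [behead (belast b p)] lists its internal       *)
(* vertices.                                                                  *)
Definition Tposy (T : finType) (e : rel T) (M : {set {set T}})
    (c1 c2 : seq T) (b : T) (p : seq T) : Prop :=
  [/\ [/\ blossom e M c1, is_base M c1 b,
          blossom e M c2 & is_base M c2 (last b p)],
      mm_path e M b p,
      {in behead (belast b p), forall v, (v \notin c1) && (v \notin c2)} &
      [set v in c1] :&: [set v in c2] = set0 \/ meet_in_mm_path e M c1 c2].

Definition Posy (T : finType) (e : rel T) : {set T} :=
  [set v | `[< exists M c1 c2 b p, [/\ maximum_matching e M,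
                 Tposy e M c1 c2 b p & v \in c1 ++ c2 ++ b :: p] >]].

Definition Flower (T : finType) (e : rel T) : {set T} :=
  [set v | `[< exists M c b p, [/\ maximum_matching e M,
                 Tflower e M c b p & v \in c ++ b :: p] >]].

Definition SD (T : finType) (e : rel T) : {set T} := Posy e :|: Flower e.

Definition KE (T : finType) (e : rel T) : {set T} := [set: T] :\: SD e.

Definition sterboul_deming (T : finType) (e : rel T) : Prop := KE e = set0.

(* Main.v *)
(* A maximum matching M' containing a posy through v, and a maximum matching  *)
(* M missing v, yield an M'-flower: M and M' together give an M'-alternating  *)
(* walk from v to an M'-unsaturated vertex w, and running around the posy     *)
(* (whose two blossoms serve as turning points) one can arrive at v by a      *)
(* matching edge and leave it backwards by the same edge. This is an          *)
(* alternating walk from w to w of odd length; in a shortest one no vertex is *)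
(* repeated in the same state (next edge in M' or not), so its last repeated  *)
(* vertex closes an odd cycle, a blossom, and the rest of the walk is a stem. *)
(* Hence if every vertex is in a posy and there is no flower, every maximum   *)
(* matching is perfect.                                                       *)
Require Import Defs.
From HB Require Import structures.
From mathcomp Require Import all_boot.
From mathcomp Require Import boolp.

Set Implicit Arguments.
Unset Strict Implicit.
Unset Printing Implicit Defensive.

(** If a perfect matching exists, every maximum matching is perfect, because a matching covers twice
    as many vertices as it has edges; a stem then has no unsaturated vertex to end at, so there is
    no flower and [SD] reduces to [Posy]. Conversely, [alternating_to_unsaturated] gives the walk
    from [v] to [w], [Tposy_turnable] the turn at [v], and [Tflower_of_connect] extracts a flower
    from the closed walk so formed. *)

Section Matching.
Variables (T : finType) (e : rel T).
Hypotheses (e_sym : symmetric e) (e_irr : irreflexive e).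

(** * Edges, matchings and partners *)

Lemma mem_edges x y : ([set x; y] \in edges e) = e x y.
Proof.
apply/imsetP/idP => [[[u v] /= + E]|exy]; last by exists (x, y); rewrite ?inE.
rewrite inE /= => euv.
have: x \in [set u; v] by rewrite -E !inE eqxx.
have: y \in [set u; v] by rewrite -E !inE eqxx orbT.
have: u \in [set x; y] by rewrite E !inE eqxx.
have: v \in [set x; y] by rewrite E !inE eqxx orbT.
have uv: u != v by apply: contraTneq euv => ->; rewrite e_irr.
rewrite !inE; do 4![case/orP=> /eqP ?]; subst=> //;
  by rewrite ?eqxx // in uv; rewrite // e_sym.
Qed.

Section OneMatching.
Variable M : {set {set T}}.
Hypothesis matM : is_matching e M.

Lemma edge_of_matching x y : [set x; y] \in M -> e x y.
Proof.
by move=> xyM; rewrite -mem_edges; case/andP: matM => /subsetP -> .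
Qed.

Lemma matching_edgeP a x : a \in M -> x \in a ->
  exists2 y, a = [set x; y] & e x y.
Proof.
move=> aM xa; have /andP[/subsetP sub _] := matM.
have /imsetP[[u v] /=] := sub _ aM; rewrite inE /= => euv E.
move: xa; rewrite E !inE => /orP[] /eqP->; first by exists v.
by exists u; rewrite 1?e_sym // setUC.
Qed.

Lemma matching_inj a b x : a \in M -> b \in M -> x \in a -> x \in b -> a = b.
Proof.
have /andP[_ /trivIsetP tr] := matM.
move=> aM bM xa xb; apply/eqP; apply: contraTT isT => nab.
by rewrite (disjointFr (tr a b aM bM nab) xa) in xb.
Qed.

Lemma partner_inj x y z : [set x; y] \in M -> [set x; z] \in M -> y = z.
Proof.
move=> xy xz; have E : [set x; y] = [set x; z].
  by apply: (matching_inj (x := x)); rewrite // !inE eqxx.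
have: y \in [set x; z] by rewrite -E !inE eqxx orbT.
have := edge_of_matching xy.
by rewrite !inE => exy /orP[] /eqP // yx; rewrite yx e_irr in exy.
Qed.

Lemma saturatedP x : reflect (exists y, [set x; y] \in M) (saturated M x).
Proof.
apply: (iffP bigcupP) => [[a aM xa]|[y xyM]].
  by have [y E _] := matching_edgeP aM xa; exists y; rewrite -E.
by exists [set x; y]; rewrite ?inE ?eqxx.
Qed.

Lemma card_cover_matching : #|cover M| = #|M|.*2.
Proof.
have /andP[sub /eqP <-] := matM.
rewrite (eq_bigr (fun=> 2)) ?sum_nat_const ?muln2 // => a aM.
have /imsetP[[u v]] := subsetP sub _ aM; rewrite inE /= => euv ->.
by rewrite cards2 (contraTneq _ euv) // => ->; rewrite e_irr.
Qed.

(** * Alternating walks as paths of states, and turning *)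

(* The state [(x, b)] stands for being at [x], the next edge being in [M]     *)
(* exactly when [b] holds.                                                    *)
Definition alt_step : rel (T * bool) := fun a c =>
  [&& e a.1 c.1, ([set a.1; c.1] \in M) == a.2 & c.2 == ~~ a.2].

Definition flip (a : T * bool) : T * bool := (a.1, ~~ a.2).

(** An alternating walk enters and leaves a vertex by edges of opposite kinds, so traversing it
    backwards negates every flag. *)
Lemma alt_step_flip a c : alt_step a c -> alt_step (flip c) (flip a).
Proof.
case: a c => [x b] [y d] /and3P[/= exy /eqP H /eqP ->].
by rewrite /alt_step /= !negbK e_sym exy setUC H !eqxx.
Qed.

Lemma connect_flip a c :
  connect alt_step a c -> connect alt_step (flip c) (flip a).
Proof.
case/connectP=> s + ->; elim: s a => [|d s IH] a //=.
case/andP=> /alt_step_flip ad /IH ds.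
exact: connect_trans ds (connect1 ad).
Qed.

(* [turnable (v, b)]: one can leave [v] in state [b] and come back by an edge *)
(* of the same kind, hence retrace any walk that reached [(v, b)].            *)
Definition turnable a := connect alt_step a (flip a).

Lemma turnable_backward a c :
  connect alt_step a c -> turnable c -> turnable a.
Proof.
move=> ac tc; apply: (connect_trans ac); apply: (connect_trans tc).
exact: connect_flip ac.
Qed.

(** From a state on the walk one can continue to the end and turn there; from its flip, go back to
    the start and turn there. So both flags are turnable. *)
Lemma turnable_walk a s : path alt_step a s ->
  turnable (flip a) -> turnable (last a s) ->
  forall c b, c \in a :: s -> turnable (c.1, b).
Proof.
move=> Hs ta tl c b cs.
have ac := path_connect Hs cs.
have cl : connect alt_step c (last a s).
  move: Hs; case/splitPl: cs => s1 s2 <-; rewrite cat_path last_cat.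
  by case/andP=> _ /path_connect -> //; apply: mem_last.
have: turnable c := turnable_backward cl tl.
have: turnable (flip c) := turnable_backward (connect_flip ac) ta.
by case: c {cs ac cl} => x [] /=; case: b.
Qed.

(** * From paths, blossoms and posies to walks of states *)

Lemma alt_states x y p :
  path e x (y :: p) ->
  sorted (fun a b : {set T} => (a \in M) (+) (b \in M))
    (path_edges x (y :: p)) ->
  exists s, path alt_step (x, [set x; y] \in M) s /\ map fst s = y :: p.
Proof.
elim: p x y => [|z p IH] x y /=.
  by rewrite andbT => exy _; exists [:: (y, [set x; y] \notin M)];
     rewrite /= /alt_step /= exy !eqxx.
case/andP=> exy eyp /andP[xM yM]; have [s [Hs Es]] := IH y z eyp yM.
exists ((y, [set y; z] \in M) :: s); rewrite /= Hs Es; split=> //.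
rewrite /alt_step /= exy eqxx andbT /=.
by move: xM; case: (_ \in M); case: (_ \in M).
Qed.

Lemma last_alt_state a c s : path alt_step a (c :: s) ->
  (last c s).2 =
    (last [set a.1; c.1] (path_edges c.1 (map fst s)) \notin M).
Proof.
elim: s a c => [|d s IH] a c /=.
  by rewrite andbT => /and3P[_ /eqP -> /eqP ->].
by case/andP=> _ /IH.
Qed.

Lemma path_edges_sub (E : {set T}) x p z :
  E \in path_edges x p -> z \in E -> z \in x :: p.
Proof.
elim: p x => [|y p IH] x //=.
rewrite !inE => /orP[/eqP -> | /IH H /H]; last first.
  by rewrite inE => ->; rewrite orbT.
by rewrite !inE => /orP[] ->; rewrite ?orbT.
Qed.

Lemma path_edges_cat (x : T) p q :
  path_edges x (p ++ q) = path_edges x p ++ path_edges (last x p) q.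
Proof. exact: pairmap_cat. Qed.

Lemma sorted_path_edges (R : rel {set T}) x p :
  (forall p1 z t p2, p = p1 ++ z :: t :: p2 ->
     R [set last x p1; z] [set z; t]) ->
  sorted R (path_edges x p).
Proof.
case: p => [|y p] //=; elim: p x y => [|z p IH] x y H //=.
rewrite (H [::] y z p) //=; apply: IH => p1 u t p2 E.
by apply: (H (y :: p1) u t p2); rewrite E.
Qed.

Lemma cycle_edges_rot (c : seq T) n : cycle_edges (rot n c) =i cycle_edges c.
Proof.
move=> E; rewrite /rot -[in RHS](cat_take_drop n c).
case: (take n c) (drop n c) => [|x p] [|y q] //=; rewrite ?cats0 //.
rewrite /path_edges /= !rcons_cat !pairmap_cat /= !mem_cat !inE.
rewrite -!cats1 !pairmap_cat !mem_cat !inE.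
by do ![case: (_ \in _) | case: (_ == _)].
Qed.

(* A non-base vertex is covered by exactly one of its two cycle edges, so the *)
(* cycle alternates away from its base.                                       *)
Lemma blossom_walk c b : blossom e M c -> is_base M c b ->
  exists s, [/\ path alt_step (b, false) s, last (b, false) s = (b, true) &
    {subset c <= map fst s}].
Proof.
case/and3P=> c2 /andP[cyc uc] _ /eqP base.
have bc : b \in c.
  by have : b \in [set b] by [rewrite inE]; rewrite -base !inE => /andP[].
have [n p Ec] := rot_to bc.
have cE E : (E \in cycle_edges c) = (E \in path_edges b (rcons p b)).
  by rewrite -(cycle_edges_rot c n) Ec.
have ep : path e b (rcons p b) by rewrite -(rot_cycle n) Ec in cyc.
have up : uniq (b :: p) by rewrite -Ec rot_uniq.
have memc x : (x \in c) = (x \in b :: p) by rewrite -Ec mem_rot.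
have nb E : E \in path_edges b (rcons p b) -> b \in E -> E \notin M.
  move=> EE bE; apply/negP=> EM.
  have : b \in [set b] by rewrite inE.
  rewrite -base !inE => /andP[/bigcupP[]]; exists E => //.
  by rewrite !inE cE EE.
have cov z : z \in p ->
    exists E, [/\ E \in path_edges b (rcons p b), E \in M & z \in E].
  move=> zp; have: z \notin [set b].
    by rewrite inE; apply: contraTneq zp => ->; case/andP: up.
  rewrite -base !inE memc inE zp orbT andbT negbK => /bigcupP[E].
  by rewrite !inE cE => /andP[? ?] ?; exists E.
have srt : sorted (fun a b : {set T} => (a \in M) (+) (b \in M))
    (path_edges b (rcons p b)).
  apply: sorted_path_edges => p1 z t p2 E.
  have E1 : b :: p = b :: p1 ++ z :: belast t p2.
    by rewrite -(belast_rcons b p b) E belast_cat /= -cat_rcons -lastI.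
  have E2 : last t p2 = b.
    by have := congr1 (last b) E; rewrite last_rcons last_cat.
  have : uniq (rcons p b) by rewrite rcons_uniq -cons_uniq.
  rewrite E cat_uniq /= => /and4P[_ Hp1 zt tp2].
  have zp : z \in p.
    by case: E1 => ->; rewrite mem_cat inE eqxx orbT.
  have zb : z != b by apply: contraTneq zp => ->; case/andP: up.
  have zp1 : z \notin b :: p1.
    by rewrite inE negb_or zb; move: Hp1; rewrite negb_or => /andP[].
  (* The two neighbours of [z] on the cycle differ: otherwise the cycle has only two vertices or
     repeats one. Hence its two cycle edges cannot both be in [M]. *)
  have nt : last b p1 != t.
    apply/eqP=> Ht.
    case: p1 E E1 {zp1} Hp1 Ht => [|y p1] E E1 Hp1 /= Ht.
      case: p2 E E1 E2 {Hp1} zt tp2 => [|u p2] E E1 E2 zt /=.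
        by move: c2; rewrite -(size_rot n) Ec E1.
      by move/andP=> [+ _]; rewrite -Ht -{1}E2 /= mem_last.
    have tp1 : t \in y :: p1 by rewrite -Ht mem_last.
    by case/norP: Hp1 => _ /norP[/negP].
  have [F [Fp FM zF]] := cov z zp.
  have FF : F = [set last b p1; z] \/ F = [set z; t].
    move: Fp; rewrite E path_edges_cat /= mem_cat !inE.
    case/orP => [Fp1|/or3P[/eqP|/eqP|Fp2]]; [|by left|by right|].
      by have := path_edges_sub Fp1 zF; rewrite (negbTE zp1).
    by have := path_edges_sub Fp2 zF; rewrite (negbTE zt).
  case M1: ([set last b p1; z] \in M); case M2: ([set z; t] \in M) => //.
    by rewrite setUC in M1; rewrite (partner_inj M1 M2) eqxx in nt.
  by case: FF => FE; move: FM; rewrite FE ?M1 ?M2.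
case Ep : (rcons p b) => [|y q]; first by case: (p) Ep.
rewrite Ep in ep srt nb.
have [s [Hs Es]] := alt_states ep srt.
have yM : [set b; y] \notin M by apply: nb; rewrite /= ?inE ?eqxx.
rewrite (negbTE yM) in Hs.
exists s; split=> //.
- have lb : (last (b, false) s).1 = b.
    by rewrite -last_map Es -Ep last_rcons.
  have : (last (b, false) s).2 = true.
    case: s Hs Es {lb} => [|a s] // Hs [ay Es] /=.
    rewrite (last_alt_state Hs) Es ay /=; apply/nb.
      by rewrite /= mem_last.
    have: last b (y :: q) = b by rewrite -Ep last_rcons.
    elim/last_ind: (q) => [|q' z _] /=; first by move=> ->; rewrite !inE eqxx.
    rewrite last_rcons => ->.
    by rewrite -cats1 path_edges_cat last_cat /= !inE eqxx orbT.
  by case: (last _ _) lb => /= ? ? -> ->.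
by move=> z; rewrite memc Es -Ep mem_rcons.
Qed.

(** Each blossom turns a walk that reaches its base by a matching edge. The joining path starts and
    ends with matching edges, so it runs between two such turns and all its vertices are turnable
    with both flags. This holds for the bases in particular, and so carries over to the walks around
    the blossoms. *)
Lemma Tposy_turnable c1 c2 b p v : Tposy e M c1 c2 b p ->
  v \in c1 ++ c2 ++ b :: p -> turnable (v, false).
Proof.
case=> [[B1 b1 B2 b2] /andP[/and3P[ep _ srt] mm] _ _].
case: p ep srt mm b2 => [|y p] // ep srt /andP[fM lM] b2.
have [s [Hs Es]] := alt_states ep srt.
rewrite fM in Hs.
have [s1 [W1 l1 sub1]] := blossom_walk B1 b1.
have [s2 [W2 l2 sub2]] := blossom_walk B2 b2.
set b' := last b (y :: p) in b2 s2 W2 l2 sub2 *.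
have t1 : turnable (b, false).
  by apply/connectP; exists s1; rewrite ?l1.
have t2 : turnable (b', false).
  by apply/connectP; exists s2; rewrite ?l2.
have ls : last (b, true) s = (b', false).
  have El : (last (b, true) s).1 = b' by rewrite -last_map Es.
  have : (last (b, true) s).2 = false.
    case: s Hs Es {El} => [|a s] // Hs [ay Es] /=.
    by rewrite (last_alt_state Hs) Es ay /= lM.
  by case: (last _ _) El => /= ? ? -> ->.
have tP z d : z \in b :: y :: p -> turnable (z, d).
  rewrite -Es; have -> : b :: map fst s = map fst ((b, true) :: s) by [].
  by case/mapP=> c cs ->; apply: (turnable_walk Hs) cs; rewrite ?ls.
have tb d : turnable (b, d) by apply: tP; rewrite mem_head.
have tb' d : turnable (b', d) by apply: tP; rewrite mem_last.
rewrite !mem_cat => /or3P[/sub1|/sub2|] H; last exact: tP.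
  case/mapP: H => c cs ->; apply: (turnable_walk W1);
    rewrite ?l1; [exact: tb|exact: tb|].
  by rewrite inE cs orbT.
case/mapP: H => c cs ->; apply: (turnable_walk W2);
  rewrite ?l2; [exact: tb'|exact: tb'|].
by rewrite inE cs orbT.
Qed.

(** * From walks of states to flowers *)

Lemma alt_sorted a s : path alt_step a s ->
  sorted (fun a b : {set T} => (a \in M) (+) (b \in M))
    (path_edges a.1 (map fst s)).
Proof.
case: s => [|c s] //=; elim: s a c => [|d s IH] a c //=.
case/andP=> ac /andP[cd Hs]; rewrite (IH c d) /= ?cd //.
move: ac cd => /and3P[_ /eqP -> /eqP cE] /and3P[_ /eqP -> _].
by rewrite cE; case: (a.2).
Qed.

Lemma alt_path a s : path alt_step a s -> path e a.1 (map fst s).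
Proof.
by elim: s a => [|c s IH] a //= /andP[/and3P[-> _ _] /IH].
Qed.

Lemma alt_parity a s : path alt_step a s -> (last a s).2 = a.2 (+) odd (size s).
Proof.
elim: s a => [|c s IH] a /=; first by rewrite addbF.
by case/andP=> /and3P[_ _ /eqP E] /IH ->; rewrite E addbN addNb.
Qed.

Lemma alt_count a s : path alt_step a s ->
  count [in M] (path_edges a.1 (map fst s)) = (a.2 + size s)./2.
Proof.
elim: s a => [|c s IH] a /=; first by case: (a.2).
case/andP=> /and3P[_ /eqP E /eqP E'] /IH ->; rewrite E E'.
by case: (a.2); rewrite //= add0n addnS.
Qed.

Lemma alt_covered_in a s c : path alt_step a s -> c \in s -> ~~ c.2 ->
  exists E, [/\ E \in path_edges a.1 (map fst s), E \in M & c.1 \in E].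
Proof.
elim: s a => [|d s IH] a //= /andP[/and3P[_ /eqP adM /eqP da] Hs].
rewrite inE => /orP[/eqP -> d2|cs c2]; last first.
  by have [E [? ? ?]] := IH d Hs cs c2; exists E; rewrite inE;
     split=> //; apply/orP; right.
exists [set a.1; d.1]; rewrite !inE !eqxx orbT; split=> //.
by rewrite adM -[a.2]negbK -da.
Qed.

Lemma alt_covered_out a s c : path alt_step a s -> c \in belast a s -> c.2 ->
  exists E, [/\ E \in path_edges a.1 (map fst s), E \in M & c.1 \in E].
Proof.
elim: s a => [|d s IH] a //= /andP[/and3P[_ /eqP adM /eqP da] Hs].
rewrite inE => /orP[/eqP -> d2|cs c2]; last first.
  by have [E [? ? ?]] := IH d Hs cs c2; exists E; rewrite inE;
     split=> //; apply/orP; right.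
by exists [set a.1; d.1]; rewrite !inE !eqxx adM.
Qed.

(** Induction from the end of the walk finds the last vertex that recurs. As states are distinct, it
    recurs with the opposite flag. *)
Lemma Tflower_of_walk w a s : ~~ saturated M w ->
  path alt_step a s -> uniq (a :: s) -> last a s = (w, true) ->
  uniq (map fst (a :: s)) \/ exists c b p, Tflower e M c b p.
Proof.
move=> wM; elim: s a => [|d s IH] a; first by left.
move=> Hp Hu Hl; have [ad Hs] := andP Hp.
have [na us] := andP Hu.
have [uf|fl] := IH d Hs us Hl; last by right.
rewrite map_cons cons_uniq uf andbT.
have [|nin] := boolP (a.1 \in map fst (d :: s)); last by left.
case/mapP=> a' a's Ea; right.
have Ea' : a' = flip a.
  case: a a' Ea na a's {Hp Hu Hl ad} => [x b] [x' b'] /= <- na a's.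
  by congr (_, _); case: b b' na a's => [] [] // /negP na /na.
rewrite {}Ea' {Ea} in a's.
case/splitPr: a's Hp Hu Hl uf {IH ad Hs na us} => s1 s2.
rewrite last_cat cat_path /= map_cat /= => /and3P[H1 H12 H2] Hu Hl uf.
case: a H1 H12 H2 Hu Hl uf => x [] H1 H12 H2 Hu Hl; rewrite /flip /= => uf.
  (* With flag [true], the walk leaves [x] and re-enters it by matching edges, both leading to the
     partner of [x]; this partner would then recur later than [x]. *)
  case: s1 H1 H12 uf {Hu} => [|c s1] /=.
    by move=> _ /and3P[/= ]; rewrite e_irr.
  case/andP=> /and3P[/= _ /eqP xc /eqP c2] _ /and3P[/= _ /eqP lM /eqP l2].
  move/andP=> [+ _]; rewrite mem_cat negb_or => /andP[cs1 _].
  have l2' : (last c s1).2 = true by rewrite -[LHS]negbK -l2.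
  rewrite l2' setUC in lM.
  have Ec := partner_inj xc lM.
  case/lastP: s1 cs1 l2' Ec {lM l2} => [|s1 l] /=; first by rewrite c2.
  by rewrite last_rcons map_rcons mem_rcons inE => /norP[/eqP].
have Hc : path alt_step (x, false) (rcons s1 (x, true)).
  by rewrite rcons_path H1.
have odds1 : ~~ odd (size s1).
  have := alt_parity Hc; rewrite last_rcons size_rcons /=.
  by case: (odd _).
have odds2 : ~~ odd (size s2).
  by have := alt_parity H2; rewrite Hl /=; case: (odd _).
move: uf; rewrite cat_uniq cons_uniq /= negb_or.
case/and4P=> us1 /andP[xs1 disj] xs2 us2.
pose c := x :: map fst s1.
have cE : cycle_edges c = path_edges x (map fst (rcons s1 (x, true))).
  by rewrite map_rcons.
have uc : uniq c by rewrite /= xs1.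
exists c, x, (map fst s2).
have bl : blossom e M c.
  rewrite /blossom /ucycleb uc andbT cE (alt_count Hc) size_rcons /= size_map.
  apply/and3P; split.
  - by case: (s1) H12 odds1 => [|? []] //= /and3P[]; rewrite e_irr.
  - by have := alt_path Hc; rewrite map_rcons.
  - rewrite eqSS uphalf_half (negbTE odds1).
    by rewrite -{1}(odd_double_half (size s1)) (negbTE odds1).
have bs : is_base M c x.
  apply/eqP/setP=> z; rewrite !inE.
  have [->|zx] /= := eqVneq z x.
    (* A matching edge of the cycle at [x] would be the first edge of the stem, which leaves the
       cycle; if the stem is empty, [x] is [w], which is unsaturated. *)
    rewrite andbT; apply/bigcupP=> -[E]; rewrite !inE => /andP[Ec EM] xE.
    have [y Exy exy] := matching_edgeP EM xE.
    have yc : y \in c.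
      have : y \in E by rewrite Exy !inE eqxx orbT.
      move/(path_edges_sub Ec); rewrite !inE -/c mem_rcons inE.
      by rewrite orbA orbb.
    case: s2 H2 Hl disj {odds2 xs2 us2 Hu} => [_ /= [xw]|f s2 /=].
      by move: wM; rewrite -xw => /saturatedP[]; exists y; rewrite -Exy.
    case/andP=> /and3P[/= exf /eqP xfM _] _ _; rewrite negb_or => /andP[fs1 _].
    rewrite Exy in EM; rewrite (partner_inj EM xfM) inE in yc.
    by rewrite (negbTE fs1) orbF in yc; rewrite (eqP yc) e_irr in exf.
  have [zs1|] := boolP (z \in map fst s1); last by rewrite andbF.
  rewrite andbT; apply/negbF/bigcupP.
  have [E [EP EM zE]] : exists E, [/\ E \in cycle_edges c, E \in M & z \in E].
    rewrite cE; case/mapP: zs1 => f fs1 ->.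
    have [f2|f2] := boolP f.2.
      by apply: (alt_covered_out Hc); rewrite ?belast_rcons ?inE ?fs1 ?orbT.
    by apply: (alt_covered_in Hc); rewrite ?mem_rcons ?inE ?fs1 ?orbT.
  by exists E; rewrite // !inE EM andbT.
have last2 : last x (map fst s2) = w.
  by rewrite -[x]/((x, true).1) last_map Hl.
rewrite /Tflower bl bs size_map odds2 last2 wM /alternating_path.
rewrite (alt_path H2) (alt_sorted H2) /= xs2 us2 /=.
apply/eqP/setP=> z; rewrite !inE.
have [|zx] //= := eqVneq z x; apply/negbTE/andP=> -[zs1 zs2].
by case/hasP: disj; exists z.
Qed.

Lemma Tflower_of_connect w : ~~ saturated M w ->
  connect alt_step (w, false) (w, true) -> exists c b p, Tflower e M c b p.
Proof.
move=> wM /connectP[s Hs]; case/shortenP: Hs => s' Hs' us' _ El.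
have [|//] := Tflower_of_walk wM Hs' us' (esym El).
case: s' El {Hs' us'} => [|c s'] //= El; rewrite inE negb_or.
case/andP=> /andP[wc ws'] _; have := mem_last c s'; rewrite -El inE.
case/orP=> [/eqP Ec|ws]; first by rewrite -Ec eqxx in wc.
by rewrite (map_f fst ws) in ws'.
Qed.

End OneMatching.

(** * Comparing two matchings *)

Lemma matching_sub_closed M (K a : {set T}) x : is_matching e M ->
  (forall x y, [set x; y] \in M -> x \in K -> y \in K) ->
  a \in M -> x \in a -> x \in K -> a \subset K.
Proof.
move=> matM clos aM xa xK; have [y E _] := matching_edgeP matM aM xa.
by rewrite E subUset !sub1set xK (clos x) // -E.
Qed.

(** No edge of either matching crosses the boundary of [K], so one may take [M'] inside [K] and [M]
    outside. The result covers all that [M] covers, and also [v]. *)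
Lemma matching_swap M M' (K : {set T}) v :
  is_matching e M -> is_matching e M' ->
  (forall x y, [set x; y] \in M -> x \in K -> y \in K) ->
  (forall x y, [set x; y] \in M' -> x \in K -> y \in K) ->
  (forall x, x \in K -> saturated M' x) ->
  v \in K -> ~~ saturated M v ->
  exists2 N, is_matching e N & #|M| < #|N|.
Proof.
move=> matM matM' clos clos' sat' vK vM.
have [/subsetP eM _] := andP matM; have [/subsetP eM' _] := andP matM'.
pose N := [set a in M | ~~ (a \subset K)] :|: [set a in M' | a \subset K].
have matN : is_matching e N.
  apply/andP; split.
    by apply/subsetP=> a; rewrite !inE => /orP[/andP[/eM]|/andP[/eM']].
  apply/trivIsetP=> a b; rewrite !inE => aN bN; apply: contraNT.
  case/pred0Pn=> x /= /andP[xa xb]; apply/eqP.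
  case/orP: aN bN => /andP[aM aK] /orP[] /andP[bM bK].
  - exact: (matching_inj matM aM bM xa xb).
  - by rewrite (matching_sub_closed matM clos aM xa (subsetP bK x xb)) in aK.
  - by rewrite (matching_sub_closed matM clos bM xb (subsetP aK x xa)) in bK.
  - exact: (matching_inj matM' aM bM xa xb).
have KN x : x \in K -> x \in cover N.
  move=> xK; have /bigcupP[a aM' xa] := sat' x xK.
  apply/bigcupP; exists a => //; rewrite !inE aM'.
  by rewrite (matching_sub_closed matM' clos' aM' xa xK) orbT.
exists N => //; rewrite -ltn_double -!(card_cover_matching _) //.
apply/proper_card/properP; split; last by exists v; rewrite ?KN.
apply/subsetP=> x; have [/KN //|xK] := boolP (x \in K).
case/bigcupP=> a aM xa; apply/bigcupP; exists a => //; rewrite !inE aM.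
by apply/orP; left; apply: contra xK => /subsetP/(_ x xa).
Qed.

(* If all the vertices [K] met from [v] by edges alternately in [M'] and [M]  *)
(* were [M']-saturated, replacing [M] by [M'] inside [K] would enlarge [M].   *)
Lemma alternating_to_unsaturated M M' v :
  maximum_matching e M -> is_matching e M' -> ~~ saturated M v ->
  exists2 w, ~~ saturated M' w & connect (alt_step M') (v, true) (w, true).
Proof.
case/andP=> matM /forallP maxM matM' vM.
(* Steps by edges outside [M'] are restricted to edges of [M]. *)
pose r : rel (T * bool) := fun a c =>
  alt_step M' a c && (a.2 || ([set a.1; c.1] \in M)).
have [[w /andP[wr wM']]|no] :=
    pselect (exists w, connect r (v, true) (w, true) && ~~ saturated M' w).
  exists w => //; apply: connect_sub wr => a c /andP[ac _]; exact: connect1.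
pose K := [set x | connect r (v, true) (x, true)
                || connect r (v, true) (x, false)].
have inA x : connect r (v, true) (x, false) ->
    exists2 y, [set y; x] \in M' & connect r (v, true) (y, true).
  case/connectP=> s; case/lastP: s => [|s [y d]] //.
  rewrite rcons_path last_rcons => /andP[Hs /andP[/and3P[/= _ /eqP E /eqP]]].
  move=> Ed _ [-> Ed2]; rewrite -Ed2 in Ed.
  have l2 : (last (v, true) s).2 = true by rewrite -[LHS]negbK -Ed.
  exists (last (v, true) s).1; first by rewrite E.
  by apply/connectP; exists s; rewrite // [RHS]surjective_pairing l2.
have satA x : connect r (v, true) (x, true) -> saturated M' x.
  by move=> xA; apply: contraT => xM'; case: no; exists x; rewrite xA.
have stepA x y : [set x; y] \in M' -> connect r (v, true) (x, true) ->
    connect r (v, true) (y, false).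
  move=> xy xA; apply: connect_trans xA (connect1 _).
  by rewrite /r /alt_step /= xy (edge_of_matching matM' xy).
have closM' x y : [set x; y] \in M' -> x \in K -> y \in K.
  rewrite !inE => xy /orP[xA|/inA[z zx zA]]; first by rewrite (stepA x) ?orbT.
  by rewrite setUC in zx; rewrite (partner_inj matM' xy zx) zA.
have stepB x y : [set x; y] \in M -> connect r (v, true) (x, false) ->
    connect r (v, true) (y, true).
  (* An edge in both matchings is the one by which [x] was entered, so [y] was already reached. *)
  move=> xy xB; have [xy'|xy'] := boolP ([set x; y] \in M').
    have [z zx zA] := inA x xB; rewrite setUC in zx.
    by rewrite (partner_inj matM' xy' zx).
  apply: connect_trans xB (connect1 _).
  by rewrite /r /alt_step /= (negbTE xy') xy (edge_of_matching matM xy).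
have closM x y : [set x; y] \in M -> x \in K -> y \in K.
  rewrite !inE => xy /orP[xA|xB]; last by rewrite (stepB x).
  (* Either [x] is [v], which [M] misses, or [x] was entered by an edge of [M], whose other end is
     [y]. *)
  case/connectP: xA => s; case/lastP: s => [_ /= [Ex]|s [x' d]].
    by case/negP: vM; apply/saturatedP => //; exists y; rewrite -Ex.
  rewrite rcons_path last_rcons => /andP[Hs /andP[/and3P[/= _ _ /eqP Ed] zx]].
  move=> [Ex Ed2]; rewrite -{}Ed2 -{}Ex in Ed zx.
  case El: (last (v, true) s) Ed zx => [z []] //= _ zx.
  rewrite setUC in zx; rewrite (partner_inj matM xy zx); apply/orP; right.
  by apply/connectP; exists s.
have satK x : x \in K -> saturated M' x.
  rewrite inE => /orP[/satA //|/inA[y yx _]].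
  by apply/saturatedP => //; exists y; rewrite setUC.
have vK : v \in K by rewrite inE connect0.
have [N matN] := matching_swap matM matM' closM closM' satK vK vM.
by have := maxM N; rewrite matN /= leqNgt => /negP.
Qed.

End Matching.

Theorem theorem3p10 (T : finType) (e : rel T)
    (e_sym : symmetric e) (e_irr : irreflexive e) :
  (sterboul_deming e /\ exists M : {set {set T}}, perfect_matching e M) <->
  Posy e :\: Flower e = [set: T].
Proof.
split=> [[sd [M0 /andP[matM0 /forallP perM0]]]|PF].
  have F0 : Flower e = set0.
    apply/setP=> v; rewrite !inE; apply/asboolP=> -[M [c [b [p [maxM fl _]]]]].
    have /andP[matM /forallP maxM'] := maxM.
    case/and5P: fl => _ _ _ _ /andP[/negP + _]; apply.
    have covM0 : cover M0 = [set: T].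
      by apply/setP=> x; rewrite inE; apply: perM0.
    have : #|cover M0| <= #|cover M|.
      rewrite (card_cover_matching e_irr matM0).
      rewrite (card_cover_matching e_irr matM).
      by rewrite leq_double; have := maxM' M0; rewrite matM0.
    rewrite covM0 cardsT => le; rewrite /saturated.
    suff -> : cover M = [set: T] by rewrite inE.
    by apply/eqP; rewrite eqEcard subsetT cardsT.
  apply/setP=> v; rewrite F0 setD0; have : v \notin KE e by rewrite sd inE.
  by rewrite /KE /SD F0 setU0 !inE andbT negbK.
have F0 v : v \notin Flower e.
  by have := in_setT v; rewrite -PF in_setD => /andP[].
have Pv v : v \in Posy e.
  by have := in_setT v; rewrite -PF in_setD => /andP[].
split.
  apply/setP=> v; rewrite !inE.
  by have := Pv v; rewrite !inE => ->.
have mat0 : is_matching e set0.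
  by rewrite /is_matching sub0set; apply/trivIsetP=> A B; rewrite inE.
case: (@arg_maxnP _ set0 (is_matching e) (fun M => #|M|) mat0) => M matM maxM.
have maxM' : maximum_matching e M.
  by rewrite /maximum_matching matM; apply/forallP=> M'; apply/implyP/maxM.
exists M; rewrite /perfect_matching matM; apply/forallP=> v.
apply: contraT => vM; have := Pv v; rewrite inE => /asboolP.
move=> [M' [c1 [c2 [b [p [maxM2 posy vp]]]]]].
have matM' : is_matching e M' by case/andP: maxM2.
have [w wM' vw] := alternating_to_unsaturated e_sym e_irr maxM' matM' vM.
have vv := Tposy_turnable e_sym e_irr matM' posy vp.
have [|c [b' [p' fl]]] := Tflower_of_connect e_sym e_irr matM' wM'.
  (* The closed walk goes from [w] back to [v], turns in the posy, and returns to [w]. *)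
  have wv := connect_flip e_sym vw.
  exact: connect_trans wv (connect_trans vv vw).
have /negP[] := F0 b'; rewrite inE; apply/asboolP.
by exists M', c, b', p'; split; rewrite // mem_cat mem_head orbT.
Qed.
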